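(* Let $\Lambda$ be an artin algebra. (a) Every nonzero $\Lambda$-module lies on a finite partial syzygy quiver in $\operatorname{mod}\Lambda$. (b) If a $\Lambda$-module $A$ lies on a partial syzygy quiver $(Q,\varphi)$ in $\operatorname{mod}\Lambda$ at a vertex $v$, then $\operatorname{cx}_\Lambda(A)\ge\operatorname{cx}_Q(v)$.
   Context: An artin algebra is an algebra over a commutative artinian ring $k$ that is finitely generated as a $k$-module. All modules are finitely generated left modules, forming the category $\operatorname{mod}\Lambda$. $\Omega A$ is the kernel of a projective cover of $A$; $\Omega^0A=A$, $\Omega^{n+1}A=\Omega(\Omega^nA)$. A syzygy quiver in $\operatorname{mod}\Lambda$ is a pair $(Q,\varphi)$ where $Q$ is a quiver (possibly infinite) and $\varphi$ assigns to each vertex $v$ a $\Lambda$-module $\varphi(v)\ne 0$ such that $\Omega\varphi(v)\simeq\bigoplus_w\varphi(w)^{a_{vw}}$, where $a_{vw}$ is the number of arrows from $v$ to $w$ in $Q$ (so each vertex has finite out-degree). A partial syzygy quiver is a pair $(Q,\varphi)$ for which there is a syzygy quiver $(Q',\varphi')$ such that $Q$ is a subquiver of $Q'$ and $\varphi$ is the restriction of $\varphi'$ to the vertices of $Q$; it is finite if $Q$ is finite. The module $\varphi(v)$ is said to lie on $(Q,\varphi)$ at $v$. For $f:\mathbb{N}\to\mathbb{R}_{\ge 0}$, the complexity class $[f(n)]$ is the set of $g:\mathbb{N}\to\mathbb{R}_{\ge 0}$ for which there are $c_1,c_2>0$ with $c_1g(n)\le f(n)\le c_2g(n)$ for all but finitely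 many $n$. One sets $[f(n)]\le[g(n)]$ if there is $c>0$ with $f(n)\le c\,g(n)$ for all but finitely many $n$. $\operatorname{cx}_\Lambda(A)=[\ell_k(\Omega^nA)]$, with $\ell_k$ composition length over $k$. For a vertex $v$ of a quiver $Q$ with finite out-degrees, $\operatorname{cx}_Q(v)=[f(n)]$ with $f(n)$ the number of paths of length $n$ in $Q$ beginning at $v$. *)

(* Defs.v *)
From HB Require Import structures.
From mathcomp Require Import all_boot all_order all_algebra.
From mathcomp Require Import finmap.
From mathcomp Require Import all_classical all_reals all_analysis.

Set Implicit Arguments.
Unset Strict Implicit.
Unset Printing Implicit Defensive.

Import Order.TTheory GRing.Theory Num.Theory.
Import numFieldNormedType.Exports.

Local Open Scope classical_set_scope.
Local Open Scope ring_scope.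

Section Modules.
Variable R : pzRingType.
Implicit Types M N P A : lmodType R.

Definition submodule M (S : set M) : Prop := submod_closed (mem S).

Definition nonzero_module M : Prop := exists x : M, x != 0.

Definition fin_gen M : Prop :=
  exists (n : nat) (g : 'I_n -> M),
    forall x : M, exists c : 'I_n -> R, x = \sum_(i < n) c i *: g i.

Definition module_iso M N : Prop := exists f : {linear M -> N}, bijective f.

Definition artinian_module M : Prop :=
  forall S : nat -> set M,
    (forall n, submodule (S n)) -> (forall n, S n.+1 `<=` S n) ->
    exists m, forall n, (m <= n)%N -> S n = S m.

Definition composition_series M (n : nat) (S : nat -> set M) : Prop :=
  [/\ S 0%N = [set 0], S n = [set: M], forall i, (i <= n)%N -> submodule (S i)
    & forall i, (i < n)%N -> S i `<` S i.+1 /\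
        forall T : set M, submodule T -> S i `<=` T -> T `<=` S i.+1 ->
          T = S i \/ T = S i.+1].

(* Equal to 0 when [M] has no composition series. *)
Definition composition_length M : nat :=
  xget 0%N [set n | exists S, composition_series (M := M) n S].

Definition projective P : Prop :=
  forall M N (g : {linear M -> N}) (f : {linear P -> N}),
    (forall y, exists x, g x = y) ->
    exists h : {linear P -> M}, forall x, g (h x) = f x.

Definition superfluous M (K : set M) : Prop :=
  forall S : set M, submodule S -> [set x + y | x in S & y in K] = [set: M] ->
    S = [set: M].

Definition projective_cover P A (p : {linear P -> A}) : Prop :=
  [/\ fin_gen P, projective P, forall y, exists x, p x = y
    & superfluous [set x | p x = 0]].

End Modules.

Section Kernel.
Variables (R : pzRingType) (M N : lmodType R) (f : {linear M -> N}).

Definition in_ker : {pred M} := fun x => f x == 0.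

Fact in_ker_submod_closed : submod_closed in_ker.
Proof.
split=> [|a x y]; rewrite !unfold_in ?linear0 // => /eqP fx /eqP fy.
by rewrite linearP fx fy scaler0 addr0.
Qed.

HB.instance Definition _ := GRing.isSubmodClosed.Build R M in_ker
  in_ker_submod_closed.

Definition ker : Type := {x : M | in_ker x}.

HB.instance Definition _ := [isSub of ker for sval].
HB.instance Definition _ := [Choice of ker by <:].
HB.instance Definition _ := [SubChoice_isSubLmodule of ker by <:].

End Kernel.

Section Syzygy.
Variable R : pzRingType.

Record epi_data (A : lmodType R) := EpiData {
  epi_source : lmodType R;
  epi_map : {linear epi_source -> A}
}.

(* Syzygies are defined up to isomorphism only: a projective cover is picked
   by choice. The value [A] for modules [A] without projective cover is never
   used: over an artin algebra every finitely generated module has one. *)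
Definition Omega (A : lmodType R) : lmodType R :=
  match pselect (exists c : epi_data A, projective_cover (epi_map c)) with
  | left e => ker (epi_map (sval (cid e)))
  | right _ => A
  end.

Definition Omega_iter (n : nat) (A : lmodType R) : lmodType R :=
  iter n Omega A.

End Syzygy.

Section DirectSum.
Variables (R : pzRingType) (I : Type) (M : I -> lmodType R).

Definition dprod : Type := forall i, M i.

HB.instance Definition _ := gen_eqMixin dprod.
HB.instance Definition _ := gen_choiceMixin dprod.

Let add (x y : dprod) : dprod := fun i => x i + y i.
Let opp (x : dprod) : dprod := fun i => - x i.
Let zero : dprod := fun=> 0.
Let scale (a : R) (x : dprod) : dprod := fun i => a *: x i.

Fact dprod_addA : associative add.
Proof. by move=> x y z; apply: functional_extensionality_dep => i; exact: addrA. Qed.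
Fact dprod_addC : commutative add.
Proof. by move=> x y; apply: functional_extensionality_dep => i; exact: addrC. Qed.
Fact dprod_add0 : left_id zero add.
Proof. by move=> x; apply: functional_extensionality_dep => i; exact: add0r. Qed.
Fact dprod_addN : left_inverse zero opp add.
Proof. by move=> x; apply: functional_extensionality_dep => i; exact: addNr. Qed.

HB.instance Definition _ := GRing.isZmodule.Build dprod
  dprod_addA dprod_addC dprod_add0 dprod_addN.

Fact dprod_scaleA a b x : scale a (scale b x) = scale (a * b) x.
Proof. by apply: functional_extensionality_dep => i; exact: scalerA. Qed.
Fact dprod_scale1 : left_id 1 scale.
Proof. by move=> x; apply: functional_extensionality_dep => i; exact: scale1r. Qed.
Fact dprod_scaleDr : right_distributive scale +%R.
Proof. by move=> a x y; apply: functional_extensionality_dep => i; exact: scalerDr. Qed.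
Fact dprod_scaleDl x : {morph scale^~ x : a b / a + b}.
Proof. by move=> a b; apply: functional_extensionality_dep => i; exact: scalerDl. Qed.

HB.instance Definition _ := GRing.Zmodule_isLmodule.Build R dprod
  dprod_scaleA dprod_scale1 dprod_scaleDr dprod_scaleDl.

Definition fin_supp : {pred dprod} :=
  fun x => `[< finite_set [set i | x i != 0] >].

Fact fin_supp_submod_closed : submod_closed fin_supp.
Proof.
split=> [|a x y]; rewrite !unfold_in.
  by apply/asboolP; rewrite (_ : mkset _ = set0) // -subset0 => i /=; rewrite eqxx.
move=> /asboolP xfin /asboolP yfin; apply/asboolP.
have /sub_finite_set : [set i | (a *: x + y) i != 0] `<=`
    [set i | x i != 0] `|` [set i | y i != 0].
  move=> i /=; apply: contraPP => /not_orP[/negP/negPn/eqP xi /negP/negPn/eqP yi].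
  by apply/negP/negPn/eqP; rewrite -[LHS]/(a *: x i + y i) xi yi scaler0 addr0.
by apply; rewrite finite_setU.
Qed.

HB.instance Definition _ := GRing.isSubmodClosed.Build R dprod fin_supp
  fin_supp_submod_closed.

Definition dsum : Type := {x : dprod | fin_supp x}.

HB.instance Definition _ := [isSub of dsum for sval].
HB.instance Definition _ := [Choice of dsum by <:].
HB.instance Definition _ := [SubChoice_isSubLmodule of dsum by <:].

End DirectSum.

Definition artin_algebra (k : comPzRingType) (L : algType k) : Prop :=
  artinian_module k^o /\ fin_gen (L : lmodType k).

Section Restriction.
Variables (k : comPzRingType) (L : algType k) (M : lmodType L).

(* [M] as a [k]-module, by restriction of scalars along [k -> L]. *)
Definition restr : Type := M.

HB.instance Definition _ := GRing.Zmodule.on restr.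

Let scale (a : k) (x : restr) : restr := (a%:A : L) *: (x : M).

Fact restr_scaleA a b x : scale a (scale b x) = scale (a * b) x.
Proof. by rewrite /scale scalerA -scalerAl mul1r scalerA. Qed.
Fact restr_scale1 : left_id 1 scale.
Proof. by move=> x; rewrite /scale scale1r scale1r. Qed.
Fact restr_scaleDr : right_distributive scale +%R.
Proof. by move=> a x y; rewrite /scale scalerDr. Qed.
Fact restr_scaleDl x : {morph scale^~ x : a b / a + b}.
Proof. by move=> a b; rewrite /scale scalerDl scalerDl. Qed.

HB.instance Definition _ := GRing.Zmodule_isLmodule.Build k restr
  restr_scaleA restr_scale1 restr_scaleDr restr_scaleDl.

End Restriction.

Record quiver := Quiver {
  vertex : choiceType;
  arrow : choiceType;
  source : arrow -> vertex;
  target : arrow -> vertex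
}.

Definition finite_quiver (Q : quiver) : Prop :=
  finite_set [set: vertex Q] /\ finite_set [set: arrow Q].

Definition finite_outdegree (Q : quiver) : Prop :=
  forall v : vertex Q, finite_set [set e : arrow Q | source e = v].

(* [fset_set] is the set itself on finite sets and empty on infinite ones; it
   is only used for quivers with finite out-degrees. *)
Definition n_arrows (Q : quiver) (v w : vertex Q) : nat :=
  #|` fset_set [set e : arrow Q | source e = v /\ target e = w]|.

Fixpoint is_path (Q : quiver) (v : vertex Q) (p : seq (arrow Q)) : Prop :=
  if p is e :: p' then source e = v /\ is_path (target e) p' else True.

Definition n_paths (Q : quiver) (v : vertex Q) (n : nat) : nat :=
  #|` fset_set [set p : seq (arrow Q) | size p = n /\ is_path v p]|.

Record subquiver (Q Q' : quiver) := Subquiver {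
  sub_vertex : vertex Q -> vertex Q';
  sub_arrow : arrow Q -> arrow Q';
  sub_vertex_inj : injective sub_vertex;
  sub_arrow_inj : injective sub_arrow;
  sub_source : forall e, source (sub_arrow e) = sub_vertex (source e);
  sub_target : forall e, target (sub_arrow e) = sub_vertex (target e)
}.

Section SyzygyQuiver.
Variable R : pzRingType.

Definition syzygy_quiver (Q : quiver) (phi : vertex Q -> lmodType R) : Prop :=
  finite_outdegree Q /\
  forall v, [/\ fin_gen (phi v), nonzero_module (phi v)
    & module_iso (Omega (phi v))
        (dsum (fun w : vertex Q => {ffun 'I_(n_arrows v w) -> phi w}))].

Definition partial_syzygy_quiver (Q : quiver) (phi : vertex Q -> lmodType R) :
    Prop :=
  exists (Q' : quiver) (phi' : vertex Q' -> lmodType R) (i : subquiver Q Q'),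
    syzygy_quiver phi' /\ forall v, phi v = phi' (sub_vertex i v).

Definition lies_at (Q : quiver) (phi : vertex Q -> lmodType R)
    (v : vertex Q) (A : lmodType R) : Prop := phi v = A.

End SyzygyQuiver.

Section Complexity.
Variable R : realType.
Implicit Types f g : nat -> {nonneg R}.

Definition complexity_class f : set (nat -> {nonneg R}) :=
  [set g | exists c1 c2 : R, [/\ 0 < c1, 0 < c2
    & \forall n \near \oo, c1 * (g n)%:num <= (f n)%:num <= c2 * (g n)%:num]].

Definition class_le (C D : set (nat -> {nonneg R})) : Prop :=
  exists f g, [/\ C = complexity_class f, D = complexity_class g
    & exists c : R, 0 < c /\
        \forall n \near \oo, (f n)%:num <= c * (g n)%:num].

Definition cx_module (k : comPzRingType) (L : algType k) (A : lmodType L) :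
    set (nat -> {nonneg R}) :=
  complexity_class
    (fun n => (composition_length (restr (Omega_iter n A)))%:R%:nng).

Definition cx_quiver (Q : quiver) (v : vertex Q) : set (nat -> {nonneg R}) :=
  complexity_class (fun n => (n_paths v n)%:R%:nng).

End Complexity.

Arguments cx_module R {k L} A.
Arguments cx_quiver R {Q} v.

(* Main.v *)
Require Import Defs.
From HB Require Import structures.
From mathcomp Require Import all_boot all_order all_algebra.
From mathcomp Require Import finmap zify ring.
From mathcomp Require Import all_classical all_reals all_analysis.

(** (a) The modules [Omega^n A] that do not vanish are the vertices of a
    syzygy quiver in which each vertex has at most one outgoing arrow, and
    [A] alone is a finite subquiver of it: no decomposition into indecomposable
    modules is needed, only that syzygies are finitely generated.

    (b) Projective covers exist and are unique, so [Omega] commutes with finite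
    direct sums. Hence, by induction on [n], [Omega^n A] is the direct sum,
    over the paths of length [n] starting at [v] in the ambient syzygy quiver,
    of the modules at their ends. These are nonzero, and the length of a direct
    sum of [m] nonzero modules is at least [m].

    Both parts rest on the Hopkins-Levitzki theorem for [k]. An artinian module
    has finite length once each nonzero submodule has a maximal submodule; for
    an ideal [I] of [k], take [x] such that [x I] is minimal nonzero: then
    [x I] is a vector space over a residue field of [k], and the preimage of a
    hyperplane of it is maximal in [I]. *)

Set Implicit Arguments.
Unset Strict Implicit.
Unset Printing Implicit Defensive.

Import GRing.Theory Num.Theory.

Local Open Scope classical_set_scope.
Local Open Scope ring_scope.

(** * Submodules as sets, and the minimum condition *)

Section Submodules.
Variables (R : pzRingType) (M : lmodType R).
Implicit Types S T : set M.

Lemma submoduleP S :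
  submodule S <-> S 0 /\ forall a x y, S x -> S y -> S (a *: x + y).
Proof.
split=> [[S0 SL]|[S0 SL]].
  split; first exact: set_mem.
  by move=> a x y /mem_set Sx /mem_set Sy; apply: set_mem; exact: SL.
split; first exact: mem_set.
by move=> a x y /set_mem Sx /set_mem Sy; apply: mem_set; exact: SL.
Qed.

Lemma submodule0 S : submodule S -> S 0.
Proof. by case/submoduleP. Qed.

Lemma submoduleL S a x y : submodule S -> S x -> S y -> S (a *: x + y).
Proof. by case/submoduleP => _; apply. Qed.

Lemma submoduleD S x y : submodule S -> S x -> S y -> S (x + y).
Proof. by move=> hS Sx Sy; rewrite -[x]scale1r; exact: submoduleL. Qed.

Lemma submoduleZ S a x : submodule S -> S x -> S (a *: x).
Proof.
by move=> hS Sx; rewrite -[_ *: _]addr0; apply: submoduleL => //; exact: submodule0.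
Qed.

Lemma submoduleN S x : submodule S -> S x -> S (- x).
Proof. by move=> hS Sx; rewrite -scaleN1r; exact: submoduleZ. Qed.

Lemma submoduleB S x y : submodule S -> S x -> S y -> S (x - y).
Proof. by move=> hS Sx Sy; apply: submoduleD => //; exact: submoduleN. Qed.

Lemma submodule_sum S (I : Type) (r : seq I) (F : I -> M) :
  submodule S -> (forall i, S (F i)) -> S (\sum_(i <- r) F i).
Proof.
move=> hS SF; elim/big_rec: _ => [|i x _ Sx]; first exact: submodule0.
exact: submoduleD.
Qed.

Lemma submodule_set0 : submodule [set 0 : M].
Proof. by apply/submoduleP; split=> //= a x y -> ->; rewrite scaler0 addr0. Qed.

Lemma submoduleT : submodule [set: M].
Proof. exact/submoduleP. Qed.

Lemma submodule_sum2 S T : submodule S -> submodule T ->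
  submodule [set x + y | x in S & y in T].
Proof.
move=> hS hT; apply/submoduleP; split.
  by exists 0; [exact: submodule0|exists 0; [exact: submodule0|rewrite addr0]].
move=> a _ _ [x Sx [y Ty <-]] [x' Sx' [y' Ty' <-]].
exists (a *: x + x'); first exact: submoduleL.
exists (a *: y + y'); first exact: submoduleL.
by rewrite scalerDr addrACA.
Qed.

Lemma submoduleI S T : submodule S -> submodule T -> submodule (S `&` T).
Proof.
move=> hS hT; apply/submoduleP; split; first by split; exact: submodule0.
by move=> a x y [Sx Tx] [Sy Ty]; split; exact: submoduleL.
Qed.

Definition maximal_in (W S : set M) : Prop :=
  [/\ submodule W, W `<` S & forall T, submodule T -> W `<=` T -> T `<=` S ->
        T = W \/ T = S].

(** Without a minimal member, iterating a choice of strictly smaller members from [S0] would give a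
    descending chain that never stabilises. *)
Lemma artinian_min (hM : artinian_module M) (F : set (set M)) (S0 : set M) :
  (forall S, F S -> submodule S) -> F S0 ->
  exists S, F S /\ forall T, F T -> T `<=` S -> T = S.
Proof.
move=> Fsub FS0; apply: contrapT => nomin.
have nextP S : exists T, F S -> [/\ F T, T `<=` S & T <> S].
  have [FS|] := pselect (F S); last by exists set0.
  apply: contrapT => H; apply: nomin; exists S; split=> // T FT TS.
  by apply: contrapT => neTS; apply: H; exists T.
have [next nextE] := choice nextP.
have Fit n : F (iter n next S0).
  by elim: n => //= n IH; case: (nextE _ IH).
have [||m Em] := hM (fun n => iter n next S0).
- by move=> n; exact: Fsub.
- by move=> n /=; case: (nextE _ (Fit n)).
- by case: (nextE _ (Fit m)) => _ _; apply; apply: (Em m.+1).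
Qed.

End Submodules.

(** * Commutative artinian rings have finite length *)

Section ArtinianRing.
Variables (k : comPzRingType) (hk : artinian_module k^o).
Implicit Types I W T : set k^o.

Lemma ideal_mul I a x : submodule I -> I x -> I (a * x).
Proof. exact: submoduleZ. Qed.

Lemma submodule_mul I a : submodule I -> submodule [set a * y | y in I].
Proof.
move=> hI; apply/submoduleP; split; first by exists 0; [exact: submodule0|rewrite mulr0].
move=> b _ _ [x Ix <-] [y Iy <-]; exists (b * x + y); first exact: submoduleL.
by rewrite mulrDr mulrCA.
Qed.

Lemma exists_maximal_in I : submodule I -> I != [set 0] ->
  exists W, maximal_in W I.
Proof.
move=> hI I0.
have [y0 Iy0 y00] : exists2 y, I y & y != 0.
  apply: contrapT => H; move/eqP: I0; apply; apply/seteqP; split=> [y Iy|_ ->].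
    by apply: contrapT => /eqP y0; apply: H; exists y.
  exact: submodule0.
pose F := [set J : set k^o | exists x, J = [set x * y | y in I] /\
             exists2 y, I y & x * y != 0].
have [||_ [[x [-> [z0 Iz0 xz0]]] xmin]] :=
    @artinian_min _ _ hk F [set 1 * y | y in I].
- by move=> _ [x [-> _]]; exact: submodule_mul.
- by exists 1; split=> //; exists y0; rewrite ?mul1r.
(* [b] acts on [x I] either as zero or bijectively, by minimality of [x I] and
   the descending chain of the ideals [b^n k]. *)
have act b : (forall y, I y -> x * (b * y) = 0) \/
    exists c, forall y, I y -> x * (c * (b * y)) = x * y.
  have [|nz] := pselect (forall y, I y -> x * (b * y) = 0); first by left.
  right.
  have Eb : [set (x * b) * y | y in I] = [set x * y | y in I].
    apply: xmin.
      exists (x * b); split=> //; apply: contrapT => H; apply: nz => y Iy.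
      by rewrite mulrA; apply: contrapT => /eqP xy; apply: H; exists y.
    by move=> _ [y Iy <-]; exists (b * y); rewrite ?mulrA //; exact: ideal_mul.
  have surj n y : I y -> exists2 z, I z & x * (b ^+ n * z) = x * y.
    elim: n y => [|n IH] y Iy; first by exists y; rewrite ?expr0 ?mul1r.
    have [z Iz Ez] := IH _ Iy.
    have : [set x * y | y in I] (x * z) by exists z.
    rewrite -Eb => -[w Iw Ew]; exists w => //.
    by rewrite exprSr -Ez -mulrA mulrCA [x * (b * w)]mulrA Ew mulrCA.
  have [||m Em] := @hk (fun n => [set b ^+ n * y | y in [set: k^o]] : set k^o).
  - by move=> n; apply: submodule_mul; exact: submoduleT.
  - by move=> n _ [y _ <-]; exists (b * y); rewrite // exprSr mulrA.
  (* Now [b ^+ m = b ^+ m.+1 * c]. By [surj] every element of [x I] is a multiple of [b ^+ m], so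
     [c] inverts [b] on [x I]. *)
  have [c _ Ec] : [set b ^+ m.+1 * y | y in [set: k^o]] (b ^+ m).
    by rewrite Em //; exists 1; rewrite ?mulr1.
  exists c => y Iy; have [z Iz] := surj m y Iy.
  rewrite [x * (c * _)]mulrCA [x * (b * y)]mulrCA => <-.
  by rewrite -[in RHS]Ec exprS; ring.
pose P := [set W : set k^o | W = set0 \/
  [/\ submodule W, W `<=` I, forall y, I y -> x * y = 0 -> W y & ~ W z0]].
have [G GP Gtot|W [PW Wmax]] := @Zorn_bigcup _ P.
  have [[W0 [GW0 [w0 W0w0]]]|H] :=
      pselect (exists W, G W /\ exists w, W w); last first.
    left; rewrite -subset0 => w [W GW Ww]; apply: H.
    by exists W; split=> //; exists w.
  have GE W : G W -> forall w, W w ->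
      [/\ submodule W, W `<=` I, forall y, I y -> x * y = 0 -> W y & ~ W z0].
    by move=> GW w Ww; case: (GP _ GW) Ww => [->|].
  have [sW0 W0I W0K W0z0] := GE _ GW0 _ W0w0.
  right; split.
  - apply/submoduleP; split; first by exists W0 => //; exact: submodule0.
    move=> a u v [U GU Uu] [V GV Vv]; have [sU _ _ _] := GE _ GU _ Uu.
    have [sV _ _ _] := GE _ GV _ Vv.
    case: (Gtot _ _ GU GV) => UV.
      by exists V => //; apply: submoduleL => //; exact: UV.
    by exists U => //; apply: submoduleL => //; exact: UV.
  - by move=> u [U GU Uu]; have [_ UI _ _] := GE _ GU _ Uu; exact: UI.
  - by move=> y Iy xy; exists W0 => //; exact: W0K.
  - by move=> [U GU Uz]; have [_ _ _] := GE _ GU _ Uz.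
pose K := [set y | I y /\ x * y = 0].
have sK : submodule K.
  apply/submoduleP; split; first by split; rewrite ?mulr0 //; exact: submodule0.
  move=> a u v [Iu xu] [Iv xv]; split; first exact: submoduleL.
  by rewrite mulrDr [a *: u]/(a * u) mulrCA xu mulr0 xv addr0.
case: PW => [W0|[sW WI WK Wz0]].
  case: (Wmax K).
    by rewrite W0; split=> // K0; apply: (K0 0); exact: submodule0.
  right; split=> //; first by move=> y [].
  by move=> [_ /eqP]; exact/negP.
have Tz0 T : submodule T -> W `<` T -> T `<=` I -> T z0.
  move=> sT WT TI; apply: contrapT => nTz0; apply: (Wmax T WT); right; split=> //.
  by move=> y Iy xy; apply: WT.1; exact: WK.
(* [W] and [z0] generate [I]. If [z] is outside [W], maximality gives [z0 = w + b * z]. Were [b]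
   zero on [x I], then [b * z] and so [z0] would lie in [W]; hence some [c] inverts [b] modulo the
   kernel, and [z] is [c * z0] up to [W]. *)
have WIz z : I z -> exists w c, W w /\ z = w + c * z0.
  move=> Iz; have [Wz|nWz] := pselect (W z).
    by exists z, 0; rewrite mul0r addr0.
  pose T := [set w + v | w in W & v in [set b * z | b in [set: k^o]]].
  have [|||w Ww [_ [b _ <-] Ez0]] := Tz0 T.
  - apply: submodule_sum2 => //; apply/submoduleP; split.
      by exists 0; rewrite ?mul0r.
    move=> a _ _ [u _ <-] [v _ <-]; exists (a * u + v) => //.
    by rewrite mulrDl -mulrA.
  - split=> [w Ww|TW].
      by exists w => //; exists 0; [exists 0; rewrite ?mul0r|rewrite addr0].
    apply: nWz; apply: TW; exists 0; first exact: submodule0.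
    by exists z; [exists 1; rewrite ?mul1r|rewrite add0r].
  - move=> _ [w Ww [_ [b _ <-] <-]]; apply: submoduleD => //; first exact: WI.
    exact: ideal_mul.
  case: (act b) => [b0|[c Ec]].
    case: Wz0; rewrite -Ez0; apply: submoduleD => //; apply: WK; last exact: b0.
    exact: ideal_mul.
  exists (z - c * (b * z) - c * w), c; split.
    apply: submoduleB => //; last exact: ideal_mul.
    apply: WK; last by rewrite mulrBr Ec // subrr.
    by apply: submoduleB => //; do 2!apply: ideal_mul => //.
  by rewrite -Ez0 mulrDr addrA addrNK addrNK.
exists W; split=> //.
  by split=> // IW; apply: Wz0; exact: IW.
move=> T sT WT TI; have [TW|nTW] := pselect (T `<=` W).
  by left; apply/seteqP; split.
right; apply/seteqP; split=> // z Iz; have [w [c [Ww ->]]] := WIz _ Iz.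
apply: submoduleD => //; first exact: WT.
by apply: ideal_mul => //; apply: Tz0.
Qed.

(* Hopkins-Levitzki for commutative rings. *)
Lemma artinian_composition_series :
  exists n S, composition_series (M := k^o) n S.
Proof.
have nextP I : exists W, submodule I ->
    submodule W /\ (I = [set 0] \/ maximal_in W I).
  have [hI|] := pselect (submodule I); last by exists set0.
  have [->|I0] := eqVneq I [set 0].
    by exists [set 0] => _; split; [exact: submodule_set0|left].
  have [W hW] := exists_maximal_in hI I0; exists W => _.
  by split; [case: hW|right].
have [next nextE] := choice nextP.
pose C n := iter n next [set: k^o].
have sC n : submodule (C n).
  by elim: n => [|n /nextE[]] //; exact: submoduleT.
have Cmax n : C n <> [set 0] -> maximal_in (C n.+1) (C n).
  by move=> Cn0; case: (nextE _ (sC n)) => _ [].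
have ex0 : exists m, `[< C m = [set 0] >].
  have [||_ [[m _ <-] Cmin]] := @artinian_min _ _ hk (range C) (C 0%N).
  - by move=> _ [n _ <-]; exact: sC.
  - by exists 0%N.
  exists m; apply/asboolP; apply: contrapT => /Cmax[_ [CS nCS] _].
  by apply: nCS; rewrite (Cmin (C m.+1)) //; exists m.+1.
(* The least [m] is taken, so that all earlier terms are nonzero and each step of the chain is a
   passage to a maximal submodule. Reading it backwards gives the series. *)
case: (ex_minnP ex0) => m /asboolP Cm0 m_min.
exists m, (fun i => C (m - i)%N); split; rewrite ?subn0 ?subnn //.
move=> i im; have [|_ CS Cmx] := Cmax (m - i.+1)%N.
  by move=> /asboolP /m_min; lia.
have Ei : (m - i = (m - i.+1).+1)%N by lia.
by rewrite Ei; split=> // T sT; exact: Cmx.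
Qed.

End ArtinianRing.

(** * Rank functions as a measure of finite length *)

Section Rank.

(** Ranks are sums over layers; this passes from equal ranks to equality in every layer. *)
Lemma leq_sum_eq n (F G : nat -> nat) : (forall i, (i < n)%N -> F i <= G i)%N ->
  (\sum_(i < n) G i <= \sum_(i < n) F i)%N ->
  forall i, (i < n)%N -> (G i <= F i)%N.
Proof.
elim: n => // n IH FG; rewrite !big_ord_recr /= => leGF i.
have FG' j : (j < n)%N -> (F j <= G j)%N by move=> jn; apply: FG; exact: ltnW.
have : (\sum_(i < n) F i <= \sum_(i < n) G i)%N.
  by apply: leq_sum => -[j jn] _; exact: FG'.
have := FG n (leqnn _) => FGn sFG.
rewrite ltnS leq_eqVlt => /orP[/eqP->|]; last first.
  by apply: IH => //; rewrite -(leq_add2r (G n)) (leq_trans leGF) // leq_add2l.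
rewrite -(leq_add2l (\sum_(j < n) F j)%N) (leq_trans _ leGF) //.
by rewrite leq_add2r.
Qed.

Variables (R : pzRingType) (M : lmodType R).
Implicit Types S T : set M.

(* A substitute for the length of submodules, which need not be additive: only
   its bound [n] is compared with lengths. *)
Definition rank_function (d : set M -> nat) (n : nat) : Prop :=
  [/\ forall S, submodule S -> (d S <= n)%N,
      forall S T, submodule S -> submodule T -> S `<=` T -> (d S <= d T)%N
    & forall S T, submodule S -> submodule T -> S `<=` T -> (d T <= d S)%N ->
        T `<=` S].

(** The rank of [S] counts the layers [C i.+1 / C i] in which [S] has a nonzero trace. If [S] and
    [T] have the same rank, they meet the same layers; where [S] meets one, simplicity gives
    [C i.+1 = C i + (S & C i.+1)], so an element of [T] in [C i.+1] can be moved into [T & C i]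
    modulo [S], and induction on [i] applies. *)
Lemma composition_series_rank n (C : nat -> set M) :
  composition_series n C -> exists d, rank_function d n.
Proof.
move=> [C0 Cn sC Csimple].
pose step S i : bool := `[< exists x, [/\ S x, C i.+1 x & ~ C i x] >].
have step_mono S T i : S `<=` T -> (step S i <= step T i)%N.
  move=> ST; rewrite /step.
  case: asboolP => [[x [Sx Cx nCx]]|] //; rewrite asboolT //.
  by exists x; split=> //; exact: ST.
exists (fun S => \sum_(i < n) step S i)%N; split.
- move=> S _; rewrite -[leqRHS]card_ord -sum1_card; apply: leq_sum => i _.
  exact: leq_b1.
- by move=> S T _ _ ST; apply: leq_sum => i _; exact: step_mono.
move=> S T sS sT ST leTS.
have eqST i : (i < n)%N -> step T i -> step S i.
  move=> iln Ti; have := leq_sum_eq (fun j _ => step_mono S T j ST) leTS iln.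
  by rewrite Ti; case: (step S i).
suff TC i : (i <= n)%N -> T `&` C i `<=` S.
  by move=> t Tt; apply: (TC n) => //; split=> //; rewrite Cn.
elim: i => [_ t [_]|i IH iln t [Tt Ct]].
  by rewrite C0 => ->; exact: submodule0.
have [Cit|nCit] := pselect (C i t).
  by apply: IH => //; exact: ltnW.
have /asboolP[x [Sx Cx nCx]] : step S i.
  by apply: eqST => //; apply/asboolP; exists t.
have sCi : submodule (C i) by apply: sC; exact: ltnW.
have sCi1 : submodule (C i.+1) by exact: sC.
have [[CC _] Cmax] := Csimple i iln.
have := Cmax [set u + v | u in C i & v in S `&` C i.+1].
case.
- by apply: submodule_sum2 => //; exact: submoduleI.
- move=> u Cu; exists u => //; exists 0; last by rewrite addr0.
  by split; exact: submodule0.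
- by move=> _ [u Cu [v [_ Cv] <-]]; apply: submoduleD => //; exact: CC.
- move=> E; case: nCx; rewrite -E; exists 0; first exact: submodule0.
  by exists x; rewrite ?add0r.
move=> E; move: Ct; rewrite -E => -[u Cu [v [Sv _] tE]].
rewrite -tE; apply: submoduleD => //; apply: IH; first exact: ltnW.
split=> //; have -> : u = t - v by rewrite -tE addrK.
by apply: submoduleB => //; exact: ST.
Qed.

Variables (d : set M -> nat) (n : nat).
Hypothesis dP : rank_function d n.

Lemma rank_argmax (F : set (set M)) S0 : (forall S, F S -> submodule S) ->
  F S0 -> exists S, F S /\ forall T, F T -> (d T <= d S)%N.
Proof.
move=> sF FS0; pose P m := `[< exists S, F S /\ d S = m >].
have exP : exists m, P m by exists (d S0); apply/asboolP; exists S0.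
have Pn m : P m -> (m <= n)%N.
  by move=> /asboolP[S [FS <-]]; case: dP => + _ _; apply; exact: sF.
case: (ex_maxnP exP Pn) => m /asboolP[S [FS dS]] mmax.
by exists S; split=> // T FT; rewrite dS; apply: mmax; apply/asboolP; exists T.
Qed.

Lemma rank_argmin (F : set (set M)) S0 : F S0 ->
  exists S, F S /\ forall T, F T -> (d S <= d T)%N.
Proof.
move=> FS0; pose P m := `[< exists S, F S /\ d S = m >].
have exP : exists m, P m by exists (d S0); apply/asboolP; exists S0.
case: (ex_minnP exP) => m /asboolP[S [FS dS]] mmin.
by exists S; split=> // T FT; rewrite dS; apply: mmin; apply/asboolP; exists T.
Qed.

(** A proper submodule of largest rank works: a proper submodule above it has no larger rank, so
    equals it. *)
Lemma rank_exists_maximal_in T : submodule T -> T <> [set 0] ->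
  exists W, maximal_in W T.
Proof.
move=> sT T0.
have [||W [[sW [WT nTW]] Wmax]] := @rank_argmax
    [set W | submodule W /\ W `<` T] [set 0].
- by move=> S [].
- split; first exact: submodule_set0.
  split=> [_ ->|TS]; first exact: submodule0.
  by apply: T0; apply/seteqP; split=> // _ ->; exact: submodule0.
exists W; split=> // U sU WU UT.
have [TU|nTU] := pselect (T `<=` U); first by right; apply/seteqP.
left; apply/seteqP; split=> //; case: dP => _ _; apply=> //.
by apply: Wmax; split.
Qed.

Lemma rank_composition_series : exists m C, composition_series (M := M) m C.
Proof.
(* Series are built up to every submodule [T], by induction on a bound for its rank, peeling off a
   maximal submodule from the top. *)
suff H m T : submodule T -> (d T < m)%N -> exists l (C : nat -> set M),
    [/\ C 0%N = [set 0], C l = T, forall i, (i <= l)%N -> submodule (C i)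
    & forall i, (i < l)%N -> C i `<` C i.+1 /\
        forall U : set M, submodule U -> C i `<=` U -> U `<=` C i.+1 ->
          U = C i \/ U = C i.+1].
  by case: (H _ [set: M] (submoduleT M) (leqnn _)) => l [C CP]; exists l, C.
elim: m T => // m IH T sT dT.
have [->|T0] := pselect (T = [set 0]).
  by exists 0%N, (fun=> [set 0]); split=> // i _; exact: submodule_set0.
have [W [sW [WT nTW] Wmax]] := rank_exists_maximal_in sT T0.
have [|l [C [C0 Cl sC Cs]]] := IH W sW.
  rewrite -ltnS (leq_trans _ dT) // ltnS ltnNge; apply/negP => dTW; apply: nTW.
  by case: dP => _ _; apply.
exists l.+1, (fun i => if (i <= l)%N then C i else T); split=> //.
- by rewrite ltnn.
- by move=> i _; case: ifP => // /sC.
move=> i; rewrite ltnS => il; rewrite il; move: il; rewrite leq_eqVlt.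
case/orP => [/eqP->|il]; first by rewrite ltnn Cl.
by rewrite il; exact: Cs.
Qed.

End Rank.

(** [xget] picks the length of some composition series, and that very series supplies the rank. *)
Lemma composition_length_rank (R : pzRingType) (M : lmodType R) :
  (exists m C, composition_series (M := M) m C) ->
  exists d, rank_function (M := M) d (composition_length M).
Proof.
by move=> /(@xgetPex _ 0%N [set m | exists C, composition_series m C]) [C];
  exact: composition_series_rank.
Qed.

(** * Finitely generated modules inherit ranks from the ring *)

Section FinGen.
Variables (R : pzRingType).

(* The rank of [S] adds up the ranks of the ideals of leading coefficients
   [{a | a g_j is in S modulo g_0, ..., g_(j-1)}]. *)
Lemma fin_gen_rank (M : lmodType R) (d : set R^o -> nat) n :
  rank_function d n -> fin_gen M -> exists d' n', rank_function (M := M) d' n'.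
Proof.
move=> [dn dmono dstrict] [m [g gP]].
(* Continuing [g] by zero lets the spans [G j] of the first [j] generators be indexed by all natural
   numbers. *)
pose g' i : M := if insub i is Some j then g j else 0.
pose G j := [set x | exists c : nat -> R, x = \sum_(i < j) c i *: g' i].
have sG j : submodule (G j).
  apply/submoduleP; split.
    by exists (fun=> 0); rewrite big1 // => i _; rewrite scale0r.
  move=> a _ _ [c ->] [e ->]; exists (fun i => a * c i + e i).
  rewrite scaler_sumr -big_split /=; apply: eq_bigr => i _.
  by rewrite scalerDl scalerA.
pose I (S : set M) j : set R^o := [set a | exists2 u, G j u & S (a *: g' j + u)].
have sI S j : submodule S -> submodule (I S j).
  move=> sS; apply/submoduleP; split.
    exists 0; first exact: submodule0.
    by rewrite scale0r addr0; exact: submodule0.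
  move=> a x y [u Gu Su] [v Gv Sv]; exists (a *: u + v); first exact: submoduleL.
  have -> : (a * (x : R) + (y : R)) *: g' j + (a *: u + v) =
      a *: ((x : R) *: g' j + u) + ((y : R) *: g' j + v).
    by rewrite scalerDl scalerDr scalerA addrACA.
  exact: submoduleL.
have I_mono S T j : S `<=` T -> I S j `<=` I T j.
  by move=> ST a [u Gu Su]; exists u => //; exact: ST.
exists (fun S => \sum_(j < m) d (I S j))%N, (m * n)%N; split.
- move=> S sS; rewrite -[m in leqRHS]card_ord -sum_nat_const; apply: leq_sum => j _.
  by apply: dn; exact: sI.
- move=> S T sS sT ST; apply: leq_sum => j _; apply: dmono; try exact: sI.
  exact: I_mono.
move=> S T sS sT ST leTS.
have eqI j : (j < m)%N -> I T j `<=` I S j.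
  move=> jm; apply: dstrict; [exact: sI|exact: sI|exact: I_mono|].
  apply: (leq_sum_eq (n := m) (F := fun j => d (I S j))
    (G := fun j => d (I T j))) => //.
  by move=> i _; apply: dmono; [exact: sI|exact: sI|exact: I_mono].
suff TG j : (j <= m)%N -> T `&` G j `<=` S.
  move=> t Tt; apply: (TG m) => //; split=> //; have [c ->] := gP t.
  exists (fun i => if insub i is Some j then c j else 0).
  apply: eq_bigr => i _; rewrite /g' insubT //= => ilt.
  by congr (c _ *: g _); exact: val_inj.
elim: j => [_ t [_ [c]]|j IH jm t [Tt [c tE]]].
  by rewrite big_ord0 => ->; exact: submodule0.
rewrite big_ord_recr /= addrC in tE.
(* The leading coefficient [c j] of [t] also occurs in [S]; subtracting the element of [S] that
   carries it leaves an element of [T] in [G j]. *)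
have [|u Gu Su] := eqI j jm (c j).
  exists (\sum_(i < j) c i *: g' i); first by exists c.
  by rewrite -tE.
have -> : t = (t - (c j *: g' j + u)) + (c j *: g' j + u) by rewrite addrNK.
apply: submoduleD => //; apply: IH; first exact: ltnW.
split; first by apply: submoduleB => //; exact: ST.
rewrite [in X in G j X]tE opprD addrACA subrr add0r; apply: submoduleB => //.
by exists c.
Qed.

Lemma fin_genP (M : lmodType R) (I : finType) (g : I -> M) :
  (forall x, exists c : I -> R, x = \sum_i c i *: g i) -> fin_gen M.
Proof.
move=> gP; exists #|I|, (fun i => g (enum_val i)) => x.
have [c ->] := gP x; exists (fun i => c (enum_val i)).
by rewrite (reindex _ (onW_bij _ (@enum_val_bij I))).
Qed.

Lemma fin_gen_surj (M N : lmodType R) (f : {linear M -> N}) :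
  (forall y, exists x, f x = y) -> fin_gen M -> fin_gen N.
Proof.
move=> fs [n [g gP]]; exists n, (f \o g) => y; have [x <-] := fs y.
have [c ->] := gP x; exists c; rewrite linear_sum; apply: eq_bigr => i _.
by rewrite linearZ.
Qed.

Lemma module_iso_fin_gen (M N : lmodType R) :
  module_iso M N -> fin_gen M -> fin_gen N.
Proof.
by move=> [f [g gK fK]]; apply: (@fin_gen_surj _ _ f) => y; exists (g y).
Qed.

(** Among the finitely generated submodules of the kernel, viewed inside [M], take one of largest
    rank: adjoining any further [x] to its generators cannot enlarge it. *)
Lemma fin_gen_ker (M N : lmodType R) (f : {linear M -> N}) d n :
  rank_function (M := M) d n -> fin_gen (ker f).
Proof.
move=> dP; pose span m (g : 'I_m -> ker f) :=
  [set x | exists c : 'I_m -> R, x = \sum_i c i *: val (g i)].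
have sspan m g : submodule (@span m g).
  apply/submoduleP; split.
    by exists (fun=> 0); rewrite big1 // => i _; rewrite scale0r.
  move=> a _ _ [c ->] [e ->]; exists (fun i => a * c i + e i).
  rewrite scaler_sumr -big_split /=; apply: eq_bigr => i _.
  by rewrite scalerDl scalerA.
have [||_ [[m [g ->]] gmax]] := rank_argmax dP
    (F := [set S | exists m g, S = @span m g]) (S0 := span 0 (fun=> 0)).
- by move=> _ [m [g ->]].
- by exists 0%N, (fun=> 0).
exists m, g => x.
pose g' (i : 'I_m.+1) := oapp g x (unlift ord0 i).
have [c xE] : span m g (val x).
  case: dP => _ _ /(_ (span m g) (span _ g')); apply=> //.
  - move=> _ [c ->]; exists (fun i => oapp c 0 (unlift ord0 i)).
    rewrite big_ord_recl unlift_none /= scale0r add0r; apply: eq_bigr => i _.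
    by rewrite /g' liftK.
  - by apply: gmax; exists m.+1, g'.
  exists (fun i => oapp (fun=> 0) 1 (unlift ord0 i)).
  rewrite big_ord_recl unlift_none /= /g' unlift_none /= scale1r big1 ?addr0 //.
  by move=> i _; rewrite liftK /= scale0r.
by exists c; apply: val_inj; rewrite xE linear_sum.
Qed.

End FinGen.

(** * Linear maps, isomorphisms and binary products *)

Section Linear.
Variable R : pzRingType.
Implicit Types M N A B : lmodType R.

Lemma linear_exists M N (f : M -> N) : linear f ->
  exists g : {linear M -> N}, g =1 f.
Proof.
move=> lf; pose g : {linear M -> N} :=
  HB.pack_for {linear M -> N} f (GRing.isLinear.Build R M N _ f lf).
by exists g.
Qed.

Lemma bij_module_iso M N (f : {linear M -> N}) :
  (forall x, f x = 0 -> x = 0) -> (forall y, exists x, f x = y) ->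
  module_iso M N.
Proof.
move=> finj /choice[g gK]; exists f; exists g => // x.
by apply/eqP; rewrite -subr_eq0; apply/eqP/finj; rewrite linearB gK subrr.
Qed.

Lemma module_iso_refl M : module_iso M M.
Proof. by exists idfun; exists idfun. Qed.

Lemma module_iso_trans M N A :
  module_iso M N -> module_iso N A -> module_iso M A.
Proof. by move=> [f bf] [g bg]; exists (g \o f); exact: bij_comp. Qed.

Lemma module_iso_sym M N : module_iso M N -> module_iso N M.
Proof.
move=> [f [g gK fK]]; have [|h hE] := @linear_exists _ _ g.
  by move=> a x y; apply: (can_inj gK); rewrite linearP !fK.
by exists h; exists f => x; rewrite hE.
Qed.

Lemma module_iso_prod M N A B : module_iso M N -> module_iso A B ->
  module_iso (M * A)%type (N * B)%type.
Proof.
move=> [f [f' fK f'K]] [g [g' gK g'K]].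
have [|h hE] := @linear_exists (M * A)%type (N * B)%type
    (fun x => (f x.1, g x.2)).
  by move=> a [x x'] [y y'] /=; rewrite !linearP.
exists h; exists (fun x => (f' x.1, g' x.2)) => -[x y]; rewrite !hE /=.
  by rewrite fK gK.
by rewrite f'K g'K.
Qed.

Lemma module_iso_prodA M N A :
  module_iso (M * (N * A))%type (M * N * A)%type.
Proof.
have [|h hE] := @linear_exists (M * (N * A))%type (M * N * A)%type
    (fun x => (x.1, x.2.1, x.2.2)).
  by move=> a [x [x' x'']] [y [y' y'']].
by exists h; exists (fun x => (x.1.1, (x.1.2, x.2))) => [[x [y z]]|[[x y] z]];
  rewrite !hE.
Qed.

Lemma fin_gen_fst M N : fin_gen (M * N)%type -> fin_gen M.
Proof. by apply: (@fin_gen_surj _ _ _ fst) => x; exists (x, 0). Qed.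

Lemma fin_gen_snd M N : fin_gen (M * N)%type -> fin_gen N.
Proof. by apply: (@fin_gen_surj _ _ _ snd) => x; exists (0, x). Qed.

Lemma range_submodule M N (f : {linear M -> N}) : submodule (range f).
Proof.
apply/submoduleP; split; first by exists 0; rewrite ?linear0.
by move=> a _ _ [x _ <-] [y _ <-]; exists (a *: x + y); rewrite ?linearP.
Qed.

Lemma ker_submodule M N (f : {linear M -> N}) : submodule [set x | f x = 0].
Proof.
apply/submoduleP; split; first exact: linear0.
by move=> a x y /= fx fy; rewrite linearP fx fy scaler0 addr0.
Qed.

End Linear.

(** * Free modules of finite rank *)

Section Free.
Variables (R : pzRingType) (n : nat).
Notation free := {ffun 'I_n -> R^o}.

Definition delta (i : 'I_n) : free := [ffun j => (i == j)%:R].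

Lemma free_deltaE (x : free) : x = \sum_i (x i : R) *: delta i.
Proof.
apply/ffunP => j; rewrite sum_ffunE (bigD1 j) //= !ffunE eqxx.
rewrite [_ *: _]mulr1 big1 ?addr0 // => i /negPf ij.
by rewrite !ffunE ij scaler0.
Qed.

Lemma fin_gen_free : fin_gen free.
Proof. by exists n, delta => x; exists x; exact: free_deltaE. Qed.

Lemma free_map (M : lmodType R) (s : 'I_n -> M) :
  exists f : {linear free -> M}, (forall x, f x = \sum_i (x i : R) *: s i) /\
    forall i, f (delta i) = s i.
Proof.
have [|f fE] := @linear_exists _ free M (fun x => \sum_i (x i : R) *: s i).
  move=> a x y; rewrite scaler_sumr -big_split /=; apply: eq_bigr => i _.
  by rewrite !ffunE scalerDl scalerA.
exists f; split=> // i; rewrite fE (bigD1 i) //= ffunE eqxx scale1r big1 ?addr0//.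
by move=> j ji; rewrite ffunE eq_sym (negPf ji) scale0r.
Qed.

Lemma free_ext (M : lmodType R) (f g : {linear free -> M}) :
  (forall i, f (delta i) = g (delta i)) -> f =1 g.
Proof.
move=> fg x; rewrite [x]free_deltaE !linear_sum; apply: eq_bigr => i _.
by rewrite !linearZ fg.
Qed.

End Free.

(** * Fitting's lemma *)

Section Fitting.
Variables (R : pzRingType) (V : lmodType R) (h : {linear V -> V}).
Variables (d : set V -> nat) (n : nat).
Hypothesis dP : rank_function d n.

Lemma iter_linear m : linear (iter m h).
Proof. by elim: m => // m IH a x y /=; rewrite IH linearP. Qed.

(** For large [m] the module splits as the image plus the kernel of the [m]-th iterate of [h], and
    [e] is the projection onto the image: [e x] is the unique element of the image on which the
    iterate takes the same value as on [x]. *)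
Lemma fitting : exists m (e : {linear V -> V}),
  [/\ (0 < m)%N, forall x, e (e x) = e x & range e = range (iter m h)].
Proof.
have /choice[H HE] m : exists f : {linear V -> V}, f =1 iter m h.
  exact/linear_exists/iter_linear.
have rH m : submodule (range (H m)) by exact: range_submodule.
have kH m : submodule [set x | H m x = 0] by exact: ker_submodule.
have HD m l x : H (m + l)%N x = H m (H l x) by rewrite !HE iterD.
have rle m l : range (H (m + l)%N) `<=` range (H m).
  by move=> _ [x _ <-]; rewrite HD; exists (H l x).
have kle m l : [set x | H m x = 0] `<=` [set x | H (l + m)%N x = 0].
  by move=> x /= Hx; rewrite HD Hx linear0.
have [_ [[m1 ->] m1min]] :=
  @rank_argmin _ _ d [set S | exists m, S = range (H m)] _ (ex_intro _ 0%N erefl).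
have [|_ [[m2 ->] m2max]] := rank_argmax dP
    (F := [set S | exists m, S = [set x | H m x = 0]]) _ (ex_intro _ 0%N erefl).
  by move=> _ [m ->].
(* [m] lies beyond [m1], where the images have least rank, and [m2], where the kernels have largest
   rank, so both are stable from [m] to [m + m]. The successor makes [m] positive. *)
case: dP => _ dmono dstrict; pose m := (m1 + m2).+1.
have rmm : range (H m) `<=` range (H (m + m)%N).
  apply: dstrict => //; apply: (@leq_trans (d (range (H m1)))).
    by apply: dmono => //; rewrite /m -addnS; exact: rle.
  by apply: m1min; exists (m + m)%N.
have kmm : [set x | H (m + m)%N x = 0] `<=` [set x | H m x = 0].
  apply: dstrict => //; apply: (@leq_trans (d [set x | H m2 x = 0])).
    by apply: m2max; exists (m + m)%N.
  by apply: dmono => //; rewrite /m -addSn; exact: kle.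
have inj y z : range (H m) y -> range (H m) z -> H m y = H m z -> y = z.
  move=> [y' _ <-] [z' _ <-] E; apply/eqP; rewrite -subr_eq0 -linearB.
  by apply/eqP/kmm; rewrite /= HD linearB linearB E subrr.
have /choice[e eP] x : exists y, range (H m) y /\ H m y = H m x.
  have [z _ Ez] := rmm _ (imageT (H m) x).
  by exists (H m z); rewrite -HD.
have [|e' e'E] := @linear_exists _ _ _ e.
  move=> a x y; have [[rx Ex] [ry Ey]] := (eP x, eP y).
  have [r E] := eP (a *: x + y); apply: inj => //.
    by apply: submoduleL.
  by rewrite E !linearP Ex Ey.
exists m, e'; split=> // [x|].
  rewrite !e'E; have [[r E] [r' E']] := (eP x, eP (e x)).
  by apply: inj => //; rewrite E'.
rewrite (_ : range (iter m h) = range (H m)); last first.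
  by apply/seteqP; split=> _ [x _ <-]; exists x; rewrite ?HE.
apply/seteqP; split=> [_ [x _ <-]|_ [x _ <-]].
  by rewrite e'E; case: (eP x).
exists (H m x) => //; rewrite e'E; apply: inj; first by case: (eP (H m x)).
  by exists x.
by case: (eP (H m x)).
Qed.

End Fitting.

(** * Uniqueness of projective covers, and covers of products *)

Section Covers.
Variable R : pzRingType.

Definition essential_epi (P A : lmodType R) (p : {linear P -> A}) : Prop :=
  [/\ projective P, forall y, exists x, p x = y & superfluous [set x | p x = 0]].

Lemma essential_epi_ker (P Q A B : lmodType R) (p : {linear P -> A})
    (q : {linear Q -> B}) :
  essential_epi p -> essential_epi q -> module_iso A B ->
  module_iso (ker p) (ker q).
Proof.
move=> [projP psurj pess] [projQ qsurj qess] [phi [psi phiK psiK]].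
have [h hE] := projP _ _ q (phi \o p) qsurj.
have hsurj y : exists x, h x = y.
  have rh : range h = [set: Q].
    apply: qess; first exact: range_submodule.
    rewrite -subTset => z _; have [x px] := psurj (psi (q z)).
    exists (h x) => //; exists (z - h x); last by rewrite addrC subrK.
    by rewrite /= linearB hE /= px psiK subrr.
  by have : [set: Q] y by []; rewrite -rh => -[x _ <-]; exists x.
have [s sE] := projQ _ _ h idfun hsurj.
have ssurj x : exists y, s y = x.
  have rs : range s = [set: P].
    apply: pess; first exact: range_submodule.
    rewrite -subTset => z _; exists (s (h z)) => //; exists (z - s (h z)).
      apply: (can_inj phiK); rewrite linearB linearB.
      by rewrite -[phi (p _)]hE -[phi (p (s _))]hE sE /= subrr linear0.
    by rewrite addrC subrK.
  by have : [set: P] x by []; rewrite -rs => -[y _ <-]; exists y.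
have hinj x : h x = 0 -> x = 0.
  by have [y <-] := ssurj x; rewrite sE /= => ->; rewrite linear0.
have hker (x : ker p) : in_ker q (h (val x)).
  by apply/eqP; rewrite hE /= (eqP (valP x)) linear0.
have [|f fE] := @linear_exists _ (ker p) (ker q) (fun x => Sub (h (val x)) (hker x)).
  by move=> a x y; apply: val_inj; rewrite /= linearP.
apply: (@bij_module_iso _ _ _ f) => [x|y].
  rewrite fE => /(congr1 val) /= /hinj x0; exact: val_inj.
have [x hx] := hsurj (val y).
have px : in_ker p x.
  apply/eqP/(can_inj phiK); rewrite -[phi (p _)]hE hx linear0.
  exact/eqP/(valP y).
by exists (Sub x px); rewrite fE; apply: val_inj.
Qed.

Lemma projective_prod (P Q : lmodType R) :
  projective P -> projective Q -> projective (P * Q)%type.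
Proof.
move=> hP hQ M N g f gsurj.
have [|f1 f1E] := @linear_exists _ P N (fun x => f (x, 0)).
  by move=> a x y; rewrite -linearP; congr (f (_, _)); rewrite /= scaler0 addr0.
have [|f2 f2E] := @linear_exists _ Q N (fun x => f (0, x)).
  by move=> a x y; rewrite -linearP; congr (f (_, _)); rewrite /= scaler0 addr0.
have [h1 h1E] := hP _ _ g f1 gsurj; have [h2 h2E] := hQ _ _ g f2 gsurj.
have [|h hE] := @linear_exists _ (P * Q)%type M (fun x => h1 x.1 + h2 x.2).
  by move=> a x y /=; rewrite !linearP scalerDr addrACA.
exists h => -[x y]; rewrite hE linearD h1E h2E f1E f2E -linearD.
by congr (f (_, _)); rewrite /= ?addr0 ?add0r.
Qed.

Lemma essential_epi_prod (P Q A B : lmodType R) (p : {linear P -> A})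
    (q : {linear Q -> B}) (r : {linear (P * Q)%type -> (A * B)%type}) :
  (forall x, r x = (p x.1, q x.2)) -> essential_epi p -> essential_epi q ->
  essential_epi r.
Proof.
move=> rE [projP psurj pess] [projQ qsurj qess]; split.
- exact: projective_prod.
- move=> [a b]; have [x px] := psurj a; have [y qy] := qsurj b.
  by exists (x, y); rewrite rE /= px qy.
move=> S sS SK.
have K x : (exists s k, [/\ S s, p k.1 = 0, q k.2 = 0 & x = s + k]).
  have : [set: (P * Q)%type] x by [].
  rewrite -SK => -[s Ss [k]]; rewrite /= rE => -[pk qk <-].
  by exists s, k.
(* Superfluity of the kernel of [q], applied to the second coordinates reached by [S] modulo the
   kernel of [p]. *)
have SQ y : exists s k, [/\ S s, p k = 0 & (0, y) = s + (k, 0)].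
  have : [set y | exists s k, [/\ S s, p k = 0 & (0, y) = s + (k, 0)]] = setT.
    apply: qess.
      apply/submoduleP; split.
        exists 0, 0; split; rewrite ?linear0 //; first exact: submodule0.
        by rewrite addr0.
      move=> a y1 y2 [s [k [Ss pk E]]] [s' [k' [Ss' pk' E']]].
      exists (a *: s + s'), (a *: k + k'); split; first exact: submoduleL.
        by rewrite linearP pk pk' scaler0 addr0.
      have -> : (0, a *: y1 + y2) = a *: (0, y1) + (0, y2) :> (P * Q)%type.
        by congr (_, _); rewrite /= scaler0 addr0.
      rewrite E E' scalerDr addrACA; congr (_ + _).
      by congr (_, _); rewrite /= scaler0 addr0.
    rewrite -subTset => z _; have [s [[k l] /= [Ss pk ql E]]] := K (0, z).
    exists (z - l); last by exists l => //; rewrite subrK.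
    exists s, k; split=> //; have -> : (0, z - l) = (0, z) - (0, l) :> (P * Q)%type.
      by congr (_, _); rewrite /= subr0.
    rewrite E -addrA; congr (_ + _).
    by congr (_, _); rewrite /= ?subr0 ?subrr.
  by move=> E; have : [set: Q] y by []; rewrite -E.
(* In [(z, 0) = s + (k, l)] the stray [l] is removed by [SQ], at the cost of another element [k'] of
   the kernel of [p]. *)
have SP x : S (x, 0).
  have : [set x | S (x, 0)] = setT.
    apply: pess.
      apply/submoduleP; split; first exact: (submodule0 sS).
      move=> a x1 x2 Sx1 Sx2; rewrite /mkset.
      have -> : (a *: x1 + x2, 0) = a *: (x1, 0) + (x2, 0) :> (P * Q)%type.
        by congr (_, _); rewrite /= scaler0 addr0.
      exact: submoduleL.
    rewrite -subTset => z _; have [s [[k l] /= [Ss pk ql E]]] := K (z, 0).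
    have [s' [k' [Ss' pk' E']]] := SQ l.
    exists (z - (k + k')); last first.
      by exists (k + k'); rewrite ?subrK // /mkset linearD pk pk' addr0.
    have -> : (z - (k + k'), 0) = s + s' :> (P * Q)%type; last exact: submoduleD.
    have -> : s = (z, 0) - (k, l) by rewrite E addrK.
    have -> : s' = (0, l) - (k', 0) by rewrite E' addrK.
    by congr (_, _); rewrite /= ?add0r ?subr0 ?opprD ?addrA ?addNr.
  by move=> E; have : [set: P] x by []; rewrite -E.
rewrite -subTset => -[x y] _; have [s [k [Ss _ E]]] := SQ y.
have -> : (x, y) = (x, 0) + (0, y) :> (P * Q)%type.
  by congr (_, _); rewrite /= ?addr0 ?add0r.
by rewrite E; apply: submoduleD => //; exact: submoduleD.
Qed.

End Covers.

(** * Existence of projective covers; syzygies of products *)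

Section Syzygies.
Variable R : pzRingType.
(** The finiteness on which covers and syzygies rest; [artin_rank] supplies it for artin
    algebras. *)
Hypothesis rankR : forall M : lmodType R,
  fin_gen M -> exists d n, rank_function (M := M) d n.
Implicit Types M N A B : lmodType R.

(* Among the idempotents [e] of a free module [F] over [A] for which [e F]
   still maps onto [A], one with smallest image gives the projective cover:
   a submodule of [e F] mapping onto [A] contains, by Fitting's lemma, the
   image of another such idempotent. *)
Lemma projective_cover_exists A : fin_gen A ->
  exists c : epi_data A, projective_cover (epi_map c).
Proof.
move=> [n [g gP]]; pose free := {ffun 'I_n -> R^o} : lmodType R.
have [d [l dP]] := rankR (fin_gen_free R n).
have [p [pE _]] := free_map g.
have psurj y : exists x, p x = y.
  by have [c ->] := gP y; exists (finfun c); rewrite pE;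
    apply: eq_bigr => i _; rewrite ffunE.
have [|_ [[e [-> eK pe]] emin]] := @rank_argmin _ _ d
    [set T | exists e : {linear free -> free}, [/\ T = range e,
       forall x, e (e x) = e x & forall y, exists x, p (e x) = y]] setT.
  exists idfun; split=> //; apply/seteqP; split=> // x _; by exists x.
(* The image of the idempotent [e] is the kernel of [1 - e], which makes it a module type; [r]
   retracts the free module onto it. *)
have [|q qE] := @linear_exists _ free free (fun x => x - e x).
  by move=> a x y; rewrite linearP opprD addrACA scalerBr.
have qe x : in_ker q (e x) by rewrite /in_ker qE eK subrr.
have kerE (x : ker q) : e (val x) = val x.
  by apply/eqP; rewrite eq_sym -subr_eq0 -qE; exact: (valP x).
have [|r rE] := @linear_exists _ free (ker q) (fun x => Sub (e x) (qe x)).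
  by move=> a x y; apply: val_inj; rewrite /= linearP.
have rK (x : ker q) : r (val x) = x by apply: val_inj; rewrite rE /= kerE.
have [|pP pPE] := @linear_exists _ (ker q) A (fun x => p (val x)).
  by move=> a x y; rewrite /= linearP.
exists (EpiData pP); split=> /=.
- by apply: (fin_gen_surj (f := r)) (fin_gen_free R n) => x; exists (val x).
- move=> M N u f usurj.
  have [s sP] := choice (fun i => usurj (f (r (delta R i)))).
  have [h0 [_ h0E]] := free_map s.
  have [|h hE] := @linear_exists _ (ker q) M (fun x => h0 (val x)).
    by move=> a x y; rewrite /= linearP.
  exists h => x; rewrite hE -{2}[x]rK.
  apply: (@free_ext _ _ _ (u \o h0) (f \o r)) => i /=.
  by rewrite h0E sP.
- by move=> y; have [x <-] := pe y; exists (r x); rewrite pPE rE.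
move=> S sS SK.
have /choice[s sP] i : exists x, S x /\ pP x = pP (r (delta R i)).
  have : [set: ker q] (r (delta R i)) by [].
  rewrite -SK => -[x Sx [y /= py <-]]; exists x.
  by rewrite linearD py addr0.
(* [h] maps the free module into [S] and agrees with [e] after [p]. Fitting will turn it into an
   idempotent with image in [S]. *)
have [h [hE hd]] := free_map (fun i => val (s i)).
have ph x : p (h x) = p (e x).
  apply: (@free_ext _ _ _ (p \o h) (p \o e)) => i /=.
  by rewrite hd -pPE; case: (sP i) => _ ->; rewrite pPE rE.
have hS x : exists2 y, S y & val y = h x.
  exists (\sum_i (x i : R) *: s i).
    by apply: submodule_sum => // i; apply: submoduleZ => //; case: (sP i).
  by rewrite hE linear_sum; apply: eq_bigr => i _; rewrite linearZ.
have eh x : e (h x) = h x by have [y _ <-] := hS x; exact: kerE.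
have [m [e' [m0 e'K re']]] := fitting h dP.
(* The first application of [h] replaces [p x] by [p (e x)], which is why [m] has to be positive;
   further ones change nothing, as [e] fixes the values of [h]. *)
have phm x : p (iter m h x) = p (e x).
  case: m m0 {re'} => // m _; elim: m => [|m IH] /=; first exact: ph.
  by rewrite ph eh.
have e'S x : exists2 y, S y & val y = e' x.
  have : range e' (e' x) by exists x.
  by rewrite re' => -[z _ <-]; case: m m0 {re' phm} => // m _; exact: hS.
have re : range e `<=` range e'.
  case: dP => _ _; apply; try exact: range_submodule.
    by move=> _ [x _ <-]; have [y _ <-] := e'S x; exists (val y) => //; exact: kerE.
  apply: emin; exists e'; split=> // y; have [x <-] := pe y.
  have : range (iter m h) (iter m h x) by exists x.
  by rewrite -re' -phm => -[z _ <-]; exists z.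
rewrite -subTset => x _; have [|y _ xE] := re (val x); first by exists (val x).
have [z Sz zE] := e'S y; suff -> : x = z by [].
by apply: val_inj; rewrite zE xE.
Qed.

Lemma OmegaE A : fin_gen A ->
  exists (P : lmodType R) (p : {linear P -> A}),
  [/\ fin_gen P, essential_epi p & Omega A = ker p].
Proof.
move=> fA; rewrite /Omega; case: pselect => [e|]; last first.
  by case; exact: projective_cover_exists.
by case: (cid e) => -[P p] [? ? ? ?]; exists P, p.
Qed.

Lemma fin_gen_Omega A : fin_gen A -> fin_gen (Omega A).
Proof.
move=> /OmegaE[P [p [/rankR[d [n dP]] _ ->]]]; exact: fin_gen_ker dP.
Qed.

Lemma Omega_iso A B : fin_gen A -> module_iso A B ->
  module_iso (Omega A) (Omega B).
Proof.
move=> fA AB; have [P [p [_ pE ->]]] := OmegaE fA.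
have [Q [q [_ qE ->]]] := OmegaE (module_iso_fin_gen AB fA).
exact: essential_epi_ker.
Qed.

(** The product of the chosen covers of [A] and [B] is essential over the product, so uniqueness
    compares it with the chosen cover there; its kernel is the product of the two kernels. *)
Lemma Omega_prod A B : fin_gen (A * B)%type ->
  module_iso (Omega (A * B)%type) (Omega A * Omega B)%type.
Proof.
move=> fAB; have [P [p [_ pE ->]]] := OmegaE (fin_gen_fst fAB).
have [Q [q [_ qE ->]]] := OmegaE (fin_gen_snd fAB).
have [T [t [_ tE ->]]] := OmegaE fAB.
have [|r rE] := @linear_exists _ (P * Q)%type (A * B)%type (fun x => (p x.1, q x.2)).
  by move=> a x y; rewrite /= !linearP.
apply: (module_iso_trans (essential_epi_ker tE (essential_epi_prod rE pE qE)
  (module_iso_refl _))).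
have rp (x : ker r) : in_ker p (val x).1.
  by move: (valP x); rewrite /in_ker rE => /eqP[-> _].
have rq (x : ker r) : in_ker q (val x).2.
  by move: (valP x); rewrite /in_ker rE => /eqP[_ ->].
have [|f fE] := @linear_exists _ (ker r) (ker p * ker q)%type
    (fun x => (Sub _ (rp x), Sub _ (rq x))).
  by move=> a x y; congr (_, _); apply: val_inj.
apply: (@bij_module_iso _ _ _ f) => [x|[x y]].
  rewrite fE => -[x1 x2]; apply: val_inj.
  by rewrite [LHS]surjective_pairing x1 x2.
have rxy : in_ker r (val x, val y).
  by rewrite /in_ker rE /= (eqP (valP x)) (eqP (valP y)).
by exists (Sub _ rxy); rewrite fE; congr (_, _); apply: val_inj.
Qed.

Lemma Omega_zero A : fin_gen A -> (forall x : A, x = 0) ->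
  forall x : Omega A, x = 0.
Proof.
move=> fA A0; have [P [p [_ [_ _ pess] ->]]] := OmegaE fA => x.
apply: val_inj; have P0 : [set 0] = [set: P].
  apply: pess; first exact: submodule_set0.
  rewrite -subTset => y _; exists 0 => //; exists y; last by rewrite add0r.
  exact: A0.
by have : [set: P] (val x) by []; rewrite -P0.
Qed.

End Syzygies.

(** * Direct sums over lists *)

Section SeqSum.
Variable R : pzRingType.

Notation zero_module := {ffun 'I_0 -> R^o}.

Lemma zero_moduleE (x : zero_module) : x = 0.
Proof. by apply/ffunP => -[]. Qed.

(** Nested binary products let [Omega_prod] act by induction on the list; repeated entries account
    for multiplicities. *)
Fixpoint seq_sum (I : Type) (N : I -> lmodType R) (s : seq I) : lmodType R :=
  if s is i :: s' then (N i * seq_sum N s')%type : lmodType R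
  else zero_module : lmodType R.

Lemma seq_sum_map (I J : Type) (N : I -> lmodType R) (f : J -> I) (s : seq J) :
  seq_sum N (map f s) = seq_sum (N \o f) s.
Proof. by elim: s => //= i s ->. Qed.

Lemma seq_sum_cat (I : Type) (N : I -> lmodType R) (s t : seq I) :
  module_iso (seq_sum N s * seq_sum N t)%type (seq_sum N (s ++ t)).
Proof.
elim: s => [|i s IH] /=.
  apply: (@bij_module_iso _ _ _ snd) => [[x y] /= ->|y]; last by exists (0, y).
  by congr (_, _); exact: zero_moduleE.
apply: (module_iso_trans (module_iso_sym (module_iso_prodA _ _ _))).
exact: module_iso_prod (module_iso_refl _) IH.
Qed.

Lemma rank_surj (M N : lmodType R) (f : {linear M -> N}) (d : set M -> nat) n :
  (forall y, exists x, f x = y) -> rank_function d n ->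
  rank_function (fun S : set N => d (f @^-1` S)) n.
Proof.
move=> fs [dn dmono dstrict].
have sf (S : set N) : submodule S -> submodule (f @^-1` S).
  move=> sS; apply/submoduleP; split.
    by rewrite /preimage /= linear0; exact: (submodule0 sS).
  by move=> a x y Sx Sy; rewrite /preimage /= linearP; exact: submoduleL.
split=> [S /sf|S T /sf sS /sf sT ST|S T /sf sS /sf sT ST le].
- exact: dn.
- by apply: dmono => // x; exact: ST.
move=> y Ty; have [x xy] := fs y; rewrite -xy.
by apply: (dstrict _ _ sS sT) => [z||]; [exact: ST|by []|rewrite /preimage /= xy].
Qed.

(** The head summand has positive rank [d0], being nonzero. Adding it to the submodules of the tail
    and subtracting [d0] gives a rank on the tail with bound [n - d0]. *)
Lemma seq_sum_rank (I : Type) (N : I -> lmodType R) (s : seq I)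
    (d : set (seq_sum N s) -> nat) n :
  (forall i, nonzero_module (N i)) -> rank_function d n -> (size s <= n)%N.
Proof.
move=> N0; elim: s d n => [|i s IH] //= d n [dn dmono dstrict].
pose up (S : set (seq_sum N s)) : set (N i * seq_sum N s)%type := [set x | S x.2].
have sup S : submodule S -> submodule (up S).
  move=> sS; apply/submoduleP; split; first exact: (submodule0 sS).
  by move=> a x y Sx Sy; exact: (submoduleL _ sS).
have s0 := submodule_set0 (seq_sum N s).
have up0 S : submodule S -> up [set 0] `<=` up S.
  by move=> sS x; rewrite /up /= => ->; exact: submodule0.
pose d0 := d (up [set 0]); have d0_gt0 : (0 < d0)%N.
  rewrite lt0n; apply/eqP => d0E; have [x /eqP x0] := N0 i.
  have : [set 0 : (N i * seq_sum N s)%type] (x, 0).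
    apply: (dstrict _ (up [set 0])); rewrite -/d0 ?d0E //.
    - exact: submodule_set0.
    - exact: sup.
    - by move=> _ ->.
  by case=> /x0.
have := dn _ (sup _ s0); rewrite -/d0.
suff : (size s <= n - d0)%N by lia.
apply: (IH (fun S => d (up S) - d0)%N); split.
- by move=> S sS; apply: leq_sub2r; apply: dn; exact: sup.
- move=> S T sS sT ST; apply: leq_sub2r; apply: dmono; try exact: sup.
  by move=> x; exact: ST.
move=> S T sS sT ST le y Ty.
apply: (dstrict (up S) (up T) _ _ _ _ (0, y)) => //; try exact: sup.
  by move=> x; exact: ST.
have := dmono _ _ (sup _ s0) (sup _ sS) (up0 _ sS); rewrite -/d0.
have := dmono _ _ (sup _ s0) (sup _ sT) (up0 _ sT); rewrite -/d0; lia.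
Qed.

(** Recognises a finite direct sum by its projections; this is the bridge from families of functions
    to nested pairs. *)
Lemma module_iso_seq_sum (I : eqType) (N : I -> lmodType R) (M : lmodType R)
    (pi : forall i, {linear M -> N i}) (s : seq I) : uniq s ->
  (forall x, (forall i, i \in s -> pi i x = 0) -> x = 0) ->
  (forall y : (forall i, N i), exists x, forall i, i \in s -> pi i x = y i) ->
  module_iso M (seq_sum N s).
Proof.
move=> us pi_inj pi_surj.
pose fix tup (s : seq I) (x : M) {struct s} : seq_sum N s :=
  if s is i :: s' return seq_sum N s then (pi i x, tup s' x) else 0.
have tupL t : linear (tup t).
  elim: t => [|i t IH] a x y /=; first by rewrite scaler0 addr0.
  by rewrite linearP IH.
have tup0 t x i : i \in t -> tup t x = 0 -> pi i x = 0.
  elim: t => //= j t IH; rewrite in_cons => /orP[/eqP->|it]; first by case.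
  by case=> _; exact: IH.
have tup_surj t (z : seq_sum N t) : uniq t ->
    exists y : (forall i, N i), forall x,
      (forall i, i \in t -> pi i x = y i) -> tup t x = z.
  elim: t z => [z _|i t IH [a z] /= /andP[it ut]].
    by exists (fun=> 0) => x _; rewrite [z]zero_moduleE.
  (* [dfwith] overrides the family at [i]; as [i] does not recur in the tail, the values used there
     are untouched. *)
  have [y yP] := IH z ut; exists (dfwith y i a) => x xP; congr (_, _).
    by rewrite xP ?mem_head // dfwithin.
  apply: yP => j jt; rewrite xP ?in_cons ?jt ?orbT // dfwithout //.
  by apply: contraNneq it => ->.
have [f fE] := linear_exists (tupL s).
apply: (@bij_module_iso _ _ _ f) => [x|z].
  by rewrite fE => fx; apply: pi_inj => i /tup0; apply.
have [y yP] := tup_surj s z us; have [x xP] := pi_surj y.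
by exists x; rewrite fE; exact: yP.
Qed.

End SeqSum.

(** * Restriction of scalars *)

Section Restrict.
Variables (k : comPzRingType) (L : algType k).

(** Submodules over [L] are submodules over [k]; this lets length over [k] bound ranks over [L]. *)
Lemma rank_restr (M : lmodType L) (d : set M -> nat) n :
  rank_function (M := restr M) d n -> rank_function (M := M) d n.
Proof.
have sr (S : set M) : submodule S -> submodule (S : set (restr M)).
  move=> sS; apply/submoduleP; split; first exact: (submodule0 sS).
  by move=> a x y Sx Sy; exact: (submoduleL _ sS).
by move=> [dn dm ds]; split=> [S /sr|S T /sr ? /sr|S T /sr ? /sr]; auto.
Qed.

Lemma fin_gen_restr (M : lmodType L) : fin_gen (L : lmodType k) ->
  fin_gen M -> fin_gen (restr M).
Proof.
move=> [m [e eP]] [n [g gP]].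
apply: (@fin_genP _ _ ('I_n * 'I_m)%type
  (fun ij => (e ij.2 *: g ij.1 : M) : restr M)) => x.
have [c ->] := gP x; have /choice[b bE] i := eP (c i).
exists (fun ij => b ij.1 ij.2).
rewrite -(pair_big xpredT xpredT
  (fun i j => b i j *: ((e j *: g i : M) : restr M))) /=.
apply: eq_bigr => i _; rewrite [c i]bE scaler_suml; apply: eq_bigr => j _.
by rewrite [RHS]scalerA mulr_algl.
Qed.

End Restrict.

(** * Finite length over an artin algebra *)

Section Artin.
Variables (k : comPzRingType) (L : algType k).
Hypothesis hL : artin_algebra L.

Lemma artin_composition_series (M : lmodType L) : fin_gen M ->
  exists m C, composition_series (M := restr M) m C.
Proof.
move=> fM; case: hL => hk fL.
have [n [C /composition_series_rank[d dP]]] := artinian_composition_series hk.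
by have [d' [n' /rank_composition_series]] := fin_gen_rank dP (fin_gen_restr fL fM).
Qed.

Lemma artin_composition_length_rank (M : lmodType L) : fin_gen M ->
  exists d, rank_function (M := M) d (composition_length (restr M)).
Proof.
move=> /artin_composition_series/composition_length_rank[d /rank_restr dP].
by exists d.
Qed.

Lemma artin_rank (M : lmodType L) : fin_gen M ->
  exists d n, rank_function (M := M) d n.
Proof.
move=> /artin_composition_length_rank[d dP].
by exists d; eexists; exact: dP.
Qed.

Lemma fin_gen_Omega_iter n (A : lmodType L) :
  fin_gen A -> fin_gen (Omega_iter n A).
Proof.
move=> fA; elim: n => //= n IH; apply: fin_gen_Omega => //.
exact: artin_rank.
Qed.

End Artin.

(** * Counting paths and arrows *)

Section Paths.
Variables (Q : quiver) (outQ : finite_outdegree Q).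
Implicit Types v w : vertex Q.

Definition paths v n : set (seq (arrow Q)) := [set p | size p = n /\ is_path v p].

Lemma finite_paths v n : finite_set (paths v n).
Proof.
elim: n v => [|n IH] v.
  by apply: (@sub_finite_set _ _ [set [::]]) => // p [/size0nil].
apply: (@sub_finite_set _ _ (\bigcup_(e in [set e | source e = v])
   (cons e @` paths (target e) n))).
  move=> [|e p] [] //= [sp] [se pp]; exists e => //.
  by exists p.
apply: bigcup_finite; first exact: outQ.
by move=> e _; exact: finite_image.
Qed.

Lemma mem_paths v n p : (p \in fset_set (paths v n)) = `[< paths v n p >].
Proof.
rewrite in_fset_set; last exact: finite_paths.
by apply/idP/asboolP => [/set_mem|/mem_set].
Qed.

Lemma n_paths0 v : (n_paths v 0 <= 1)%N.
Proof.
rewrite /n_paths -/(paths v 0); apply: (@uniq_leq_size _ _ [:: [::]]).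
  exact: fset_uniq.
by move=> p; rewrite mem_paths => /asboolP[/size0nil->].
Qed.

Definition arrows v w : set (arrow Q) := [set e | source e = v /\ target e = w].

Lemma finite_arrows v w : finite_set (arrows v w).
Proof. by apply: sub_finite_set (outQ v) => e []. Qed.

Definition targets v : {fset vertex Q} :=
  fset_set (@target Q @` [set e | source e = v]).

Lemma mem_targets e : target e \in targets (source e).
Proof.
rewrite in_fset_set; first by apply: mem_set; exists e.
exact/finite_image/outQ.
Qed.

Lemma n_arrows_eq0 v w : w \notin targets v -> n_arrows v w = 0%N.
Proof.
move=> wv; rewrite /n_arrows -/(arrows v w) (_ : arrows v w = set0).
  by rewrite fset_set0 cardfs0.
rewrite -subset0 => e [se te].
by move/negP: wv; apply; rewrite -se -te; exact: mem_targets.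
Qed.

(** Paths are grouped by the end of their first arrow: the list [s] of all such extensions contains
    every path. *)
Lemma n_pathsS v n :
  (n_paths v n.+1 <= \sum_(w <- targets v) n_arrows v w * n_paths w n)%N.
Proof.
pose s := flatten [seq [seq e :: p | e <- fset_set (arrows v w),
  p <- fset_set (paths w n)] | w <- targets v].
have -> : (\sum_(w <- targets v) n_arrows v w * n_paths w n)%N = size s.
  rewrite size_flatten sumnE !big_map; apply: eq_bigr => w _.
  by rewrite size_allpairs.
apply: uniq_leq_size; first exact: fset_uniq.
move=> p; rewrite mem_paths => /asboolP[].
case: p => //= e p [sp] [se pp]; apply/flatten_mapP; exists (target e).
  by rewrite -se; exact: mem_targets.
apply: allpairs_f.
  by rewrite in_fset_set; [exact: mem_set|exact: finite_arrows].
by rewrite mem_paths; exact/asboolP.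
Qed.

(** The index set of the summands of the syzygy at [v]: each arrow out of [v] is recorded by its
    target and a number among its parallels. *)
Definition slots v : seq {w : vertex Q & 'I_(n_arrows v w)} :=
  [seq Tagged (fun w => 'I_(n_arrows v w)) i | w <- targets v,
     i <- enum 'I_(n_arrows v w)].

Lemma slots_uniq v : uniq (slots v).
Proof.
apply: allpairs_uniq_dep; first exact: fset_uniq.
  by move=> w _; exact: enum_uniq.
by move=> [w i] [w' j] _ _ /= /eqP; rewrite /Tagged => /eqP ->.
Qed.

Lemma mem_slots v u : u \in slots v.
Proof.
case: u => w i; apply/allpairsPdep; exists w, i; split=> //.
  apply: contraT => /n_arrows_eq0 E.
  by case: i => i; rewrite E.
by rewrite mem_enum.
Qed.

Lemma n_paths_slots v n :
  (n_paths v n.+1 <= \sum_(w <- map tag (slots v)) n_paths w n)%N.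
Proof.
rewrite (leq_trans (n_pathsS v n)) // big_map big_allpairs_dep /=.
apply: eq_leq; apply: eq_bigr => w _.
by rewrite big_enum /= sum_nat_const card_ord.
Qed.

End Paths.

Lemma n_paths_sub (Q Q' : quiver) (i : subquiver Q Q') v n :
  finite_outdegree Q' -> (n_paths v n <= n_paths (sub_vertex i v) n)%N.
Proof.
move=> outQ'; have pathi p w : is_path w p ->
    is_path (sub_vertex i w) (map (sub_arrow i) p).
  elim: p w => //= e p IH w [<- pp]; split; first exact: sub_source.
  by rewrite sub_target; exact: IH.
rewrite /n_paths -/(paths v n) -/(paths (sub_vertex i v) n).
have inj : injective (map (sub_arrow i)) by apply: inj_map; exact: sub_arrow_inj.
rewrite -(size_map (map (sub_arrow i))); apply: uniq_leq_size.
  by rewrite map_inj_uniq //; exact: fset_uniq.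
move=> _ /mapP[p pP ->]; rewrite mem_paths //; apply/asboolP.
have [sp pp] : paths v n p.
  (* [fset_set] is empty on infinite sets, so membership of [p] makes it a path in either case. *)
  have [pfin|pinf] := pselect (finite_set (paths v n)).
    by move: pP; rewrite in_fset_set // => /set_mem.
  by move: pP; rewrite /fset_set; case: pselect => // _; rewrite in_fset0.
by split; [rewrite size_map|exact: pathi].
Qed.

(** * Iterated syzygies along a syzygy quiver *)

Section SyzygyQuiver.
Variables (k : comPzRingType) (L : algType k).
Hypothesis hL : artin_algebra L.
Variables (Q : quiver) (phi : vertex Q -> lmodType L).

Lemma dsum_slots (v : vertex Q) : finite_outdegree Q ->
  module_iso (dsum (fun w : vertex Q => {ffun 'I_(n_arrows v w) -> phi w}))
    (seq_sum phi (map tag (slots v))).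
Proof.
move=> outQ; set M := dsum _; rewrite seq_sum_map.
have pi_ex (u : {w : vertex Q & 'I_(n_arrows v w)}) :
    exists f : {linear M -> phi (tag u)}, forall x : M, f x = val x (tag u) (tagged u).
  apply: linear_exists => a x y.
  by rewrite /= !ffunE.
pose pi u := sval (cid (pi_ex u)).
have piE u x : pi u x = val x (tag u) (tagged u) := svalP (cid (pi_ex u)) x.
apply: (module_iso_seq_sum (pi := pi)); first exact: slots_uniq.
  move=> x x0; apply: val_inj; apply: functional_extensionality_dep => w.
  apply/ffunP => i; rewrite ffunE.
  pose u := Tagged (fun w => 'I_(n_arrows v w)) i.
  by rewrite -[RHS](x0 u (mem_slots outQ u)) piE.
move=> y; pose x : dprod (fun w => {ffun 'I_(n_arrows v w) -> phi w}) :=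
  fun w => [ffun i => y (Tagged (fun w => 'I_(n_arrows v w)) i)].
(* Off the targets of [v] the component of [x] is a function on an empty type, hence zero. *)
have xfin : fin_supp x.
  apply/asboolP; apply: (@sub_finite_set _ _ [set` targets v]).
    move=> w /=; apply: contraPT => /(n_arrows_eq0 outQ) E; apply/negP; rewrite negbK.
    by apply/eqP/ffunP => i; have := ltn_ord i; rewrite {2}E.
  exact: finite_fset.
by exists (Sub x xfin : M) => -[w i] _; rewrite piE /= ffunE.
Qed.

Hypothesis phiQ : syzygy_quiver phi.

(** One step along the paths: [Omega_prod] splits off the head of the list, whose syzygy is spread
    over the slots of its vertex. *)
Lemma Omega_seq_sum (s : seq (vertex Q)) : fin_gen (seq_sum phi s) ->
  module_iso (Omega (seq_sum phi s))
    (seq_sum phi (flatten [seq map tag (slots v) | v <- s])).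
Proof.
case: phiQ => outQ phiE; elim: s => [|v s IH] /= fs.
  have [|f _] := @linear_exists _ (Omega (seq_sum phi [::])) (seq_sum phi [::]) (fun=> 0).
    by move=> a x y; rewrite scaler0 addr0.
  apply: (@bij_module_iso _ _ _ f) => [x _|y].
    by apply: (Omega_zero (artin_rank hL) fs); exact: zero_moduleE.
  by exists 0; rewrite [y]zero_moduleE linear0.
apply: (module_iso_trans (Omega_prod (artin_rank hL) fs)).
apply: module_iso_trans (seq_sum_cat _ _ _).
apply: module_iso_prod; last exact: IH (fin_gen_snd fs).
have [_ _ /module_iso_trans] := phiE v; apply.
exact: dsum_slots.
Qed.

(** Both the list and the module vary in the induction: [Omega^(n+1) M] is read as
    [Omega^n (Omega M)], and the list is replaced by that of the arrow ends. At [n = 0] the length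
    is at least the number of nonzero summands. *)
Lemma n_paths_le_length n (s : seq (vertex Q)) (M : lmodType L) :
  fin_gen M -> module_iso M (seq_sum phi s) ->
  (\sum_(v <- s) n_paths v n <= composition_length (restr (Omega_iter n M)))%N.
Proof.
case: (phiQ) => outQ phiE; elim: n s M => [|n IH] s M fM Ms.
  rewrite (@leq_trans (size s)) //.
    by rewrite -sum1_size; apply: leq_sum => v _; exact: n_paths0.
  have [d dP] := artin_composition_length_rank hL fM.
  case: Ms => f [g gK fK]; apply: (seq_sum_rank (N := phi)).
    by move=> v; case: (phiE v).
  by apply: (rank_surj (f := f) _ dP) => y; exists (g y).
rewrite /Omega_iter iterSr -/(Omega_iter n (Omega M)).
apply: leq_trans (IH (flatten [seq map tag (slots v) | v <- s]) _ _ _).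
- rewrite big_flatten big_map; apply: leq_sum => v _; exact: n_paths_slots.
- exact: (fin_gen_Omega (artin_rank hL) fM).
have MsO := Omega_iso (artin_rank hL) fM Ms; apply: (module_iso_trans MsO).
exact/Omega_seq_sum/(module_iso_fin_gen Ms).
Qed.

End SyzygyQuiver.

(** * The syzygy quiver formed by the iterated syzygies of one module *)

Section IteratedSyzygies.
Variables (k : comPzRingType) (L : algType k).
Hypothesis hL : artin_algebra L.
Variables (A : lmodType L) (fA : fin_gen A).

(** Vertices are exponents rather than modules, so isomorphic syzygies stay distinct; vanishing
    syzygies are left out, as a syzygy quiver carries nonzero modules. *)
Definition syzygy_vertex : choiceType :=
  {n : nat | `[< nonzero_module (Omega_iter n A) >]}.

Definition syzygy_arrow : choiceType :=
  {p : syzygy_vertex * syzygy_vertex | val p.2 == (val p.1).+1}.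

Definition iterated_syzygy_quiver : quiver :=
  Quiver (fun e : syzygy_arrow => (val e).1) (fun e => (val e).2).

Definition iterated_syzygy (v : vertex iterated_syzygy_quiver) : lmodType L :=
  Omega_iter (val (v : syzygy_vertex)) A.

Lemma iterated_outdegree : finite_outdegree iterated_syzygy_quiver.
Proof.
move=> v; have [[e0 e0v]|nov] :=
    pselect (exists e : arrow iterated_syzygy_quiver, source e = v); last first.
  by apply: (@sub_finite_set _ _ set0) => // e ev; apply: nov; exists e.
apply: (@sub_finite_set _ _ [set e0]) => // e ev.
apply: val_inj; move: (valP e) (valP e0) ev e0v => /=.
case: (val e) (val e0) => [v1 w1] [v2 w2] /= /eqP E1 /eqP E2 V1 V2.
by congr (_, _); [rewrite V1 V2|apply/val_inj/(etrans E1); rewrite V1 -V2 -E2].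
Qed.

Lemma iterated_n_arrows (v w : vertex iterated_syzygy_quiver) :
  n_arrows v w = (val (w : syzygy_vertex) == (val (v : syzygy_vertex)).+1).
Proof.
rewrite /n_arrows; have [vw|nvw] := boolP (_ == _); last first.
  rewrite (_ : [set _ | _] = set0) ?fset_set0 ?cardfs0 // -subset0 => e [ev ew].
  by move/negP: nvw; apply; rewrite -ev -ew; exact: (valP e).
rewrite (_ : [set _ | _] = [set (Sub (v, w) vw : syzygy_arrow)]) ?fset_set1 ?cardfs1 //.
apply/seteqP; split=> [e [ev ew]|_ ->] //; apply: val_inj.
by rewrite [LHS]surjective_pairing [(val e).1]ev [(val e).2]ew.
Qed.

(** A vertex has at most one slot. If it has none, the next syzygy is zero, since otherwise it would
    be a vertex and the end of an arrow; if it has one, the next syzygy is the module there. *)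
Lemma iterated_syzygy_quiverP : syzygy_quiver iterated_syzygy.
Proof.
split=> [|v]; first exact: iterated_outdegree.
split; [exact: (fin_gen_Omega_iter hL)|exact/asboolP/(valP (v : syzygy_vertex))|].
have slotE u : u \in slots v ->
    val (tag u : syzygy_vertex) = (val (v : syzygy_vertex)).+1.
  case: u => w i _ /=; apply/eqP; apply: contraT => /negPf vw.
  by have := ltn_ord i; rewrite {2}iterated_n_arrows vw.
have slot0 w (i : 'I_(n_arrows v w)) : val i = 0%N.
  have := ltn_ord i; rewrite {2}iterated_n_arrows => /leq_trans/(_ (leq_b1 _)).
  by rewrite ltnS leqn0 => /eqP.
have slot_uniq u u' : u \in slots v -> u' \in slots v -> u = u'.
  move=> /slotE + /slotE; case: u u' => [w i] [w' i'] /= E E'.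
  have ww : w = w' by apply/val_inj/(etrans E)/esym.
  case: _ / ww i' {E'} => i'; congr Tagged; apply: val_inj.
  by rewrite !slot0.
apply: module_iso_trans (module_iso_sym (dsum_slots _ _ iterated_outdegree)).
have := slots_uniq v; have := slotE; have := slot_uniq.
have := mem_slots iterated_outdegree (v := v).
case: (slots v) => [|u [|u' s]] slots_all slots_eq slots_tag slots_u /=.
- have O0 (x : Omega (iterated_syzygy v)) : x = 0.
    apply: contrapT => /eqP x0.
    have nz : `[< nonzero_module (Omega_iter (val (v : syzygy_vertex)).+1 A) >].
      by apply/asboolP; exists x.
    pose w : syzygy_vertex :=
      exist (fun n => `[< nonzero_module (Omega_iter n A) >]) _ nz.
    have vw : (0 < n_arrows v (w : vertex iterated_syzygy_quiver))%N.
      by rewrite iterated_n_arrows eqxx.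
    by have := slots_all (Tagged (fun w => 'I_(n_arrows v w)) (Ordinal vw)).
  have [|f _] := @linear_exists _ (Omega (iterated_syzygy v))
      (seq_sum iterated_syzygy [::]) (fun=> 0).
    by move=> a x y; rewrite scaler0 addr0.
  apply: (@bij_module_iso _ _ _ f) => [x _|y]; first exact: O0.
  by exists 0; rewrite [y]zero_moduleE linear0.
- have -> : Omega (iterated_syzygy v) = iterated_syzygy (tag u).
    by rewrite /iterated_syzygy (slots_tag u (mem_head _ _)).
  apply: module_iso_sym; apply: (@bij_module_iso _ _ _ fst) => [[x y] /= ->|x].
    by congr (_, _); exact: zero_moduleE.
  by exists (x, 0).
- exfalso; move: slots_u.
  by rewrite (slots_eq u u') /= ?inE ?eqxx ?orbT.
Qed.

End IteratedSyzygies.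

Theorem proposition5p1 (R : realType) (k : comPzRingType) (L : algType k)
    (hL : artin_algebra L) :
  (forall A : lmodType L, fin_gen A -> nonzero_module A ->
     exists (Q : quiver) (phi : vertex Q -> lmodType L),
       [/\ finite_quiver Q, partial_syzygy_quiver phi
         & exists v, lies_at phi v A]) /\
  (forall A : lmodType L, fin_gen A ->
     forall (Q : quiver) (phi : vertex Q -> lmodType L) (v : vertex Q),
       partial_syzygy_quiver phi -> lies_at phi v A ->
       class_le (cx_quiver R v) (cx_module R A)).
Proof.
split=> [A fA A0|A fA Q phi v [Q' [phi' [i [phi'Q phiE]]]] vA].
  pose v0 : syzygy_vertex A :=
    exist (fun n => `[< nonzero_module (Omega_iter n A) >]) 0%N
      (introT (asboolP _) A0).
  (* One vertex and no arrows, placed at exponent 0, where the iterated syzygy is [A] itself. *)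
  pose Q := @Quiver unit void (fun=> tt) (fun=> tt).
  exists Q, (fun=> A); split; last by exists tt.
    by split; exact: finite_finset.
  pose Q' := iterated_syzygy_quiver A.
  have vinj : injective (fun _ : vertex Q => v0 : vertex Q') by move=> [] [].
  have ainj : injective (of_void _ : arrow Q -> arrow Q') by case.
  exists Q', (@iterated_syzygy _ _ A).
  have [srcE tgtE] : (forall e : arrow Q, @source Q' (of_void _ e) = v0) /\
      (forall e : arrow Q, @target Q' (of_void _ e) = v0) by split; case.
  exists (@Subquiver Q Q' _ _ vinj ainj srcE tgtE).
  by split; first exact: iterated_syzygy_quiverP.
(* The defining functions represent the two classes; the inequality holds for every [n] with
   constant 1. *)
exists (fun n => (n_paths v n)%:R%:nng).
exists (fun n => (composition_length (restr (Omega_iter n A)))%:R%:nng).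
split=> //; exists 1; split=> //; apply: nearW => n /=.
rewrite mul1r ler_nat (leq_trans (n_paths_sub i v n phi'Q.1)) //.
have Av : module_iso A (seq_sum phi' [:: sub_vertex i v]).
  rewrite -vA phiE; apply: module_iso_sym.
  apply: (@bij_module_iso _ _ _ fst) => [[x y] /= ->|x]; last by exists (x, 0).
  by congr (_, _); exact: zero_moduleE.
by have := n_paths_le_length hL phi'Q n fA Av; rewrite big_seq1.
Qed.
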